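(* Fix a word hyperbolic group $\Gamma$, a semisimple Lie group $G$ with a pair $(P^+,P^-)$ of opposite parabolic subgroups, and a choice of domain of discontinuity $\Omega_\rho$ for every $(P^+,P^-)$-Anosov representation $\rho:\Gamma\to G$. Then the $(P^+,P^-)$-Anosov representations, with the morphism sets $$\mathrm{Hom}(\rho,\rho')=\left\{\phi\in\mathrm{Hom}(G,G)\ :\ \phi(\rho(\Gamma))\subseteq\rho'(\Gamma)\ \text{and}\ \forall g,h\in\rho(\Gamma),\ g|_{\Omega_\rho}=h|_{\Omega_\rho}\Rightarrow\phi(g)|_{\Omega_{\rho'}}=\phi(h)|_{\Omega_{\rho'}}\right\}$$ and composition of homomorphisms, form a category $\mathbf{An}$. Moreover, if the chosen domains $\Omega_\rho$ are complex curves, the assignment $\mathcal{F}$ sending each representation $\rho$ to its associated free abelian group $F^{ab}_\rho$, and each $\phi\in\mathrm{Hom}(\rho,\rho')$ to the group homomorphism $\mathcal{F}(\phi):F^{ab}_\rho\to F^{ab}_{\rho'}$ with $\mathcal{F}(\phi)(\mathcal{E}^h_\rho)=\mathcal{E}^{\phi(h)}_{\rho'}$ for all $h\in\rho(\Gamma)$, is a covariant functor from $\mathbf{An}$ to the category $\mathbf{Ab}$ of abelian groups.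
   Context: Anosov representations. $\Gamma$ is a finitely generated word hyperbolic group with boundary $\partial_\infty\Gamma$, and $\partial_\infty\Gamma^{(2)}=\partial_\infty\Gamma\times\partial_\infty\Gamma\setminus\{(t,t)\}$. $G$ is a semisimple Lie group, $(P^+,P^-)$ a pair of opposite parabolic subgroups, $\mathcal{F}^\pm=G/P^\pm$ (not to be confused with the functor $\mathcal{F}$). A pair in $\mathcal{F}^+\times\mathcal{F}^-$ is transverse if it lies in the unique open $G$-orbit of the diagonal action (this orbit is $\cong G/(P^+\cap P^-)$). $\hat\Gamma$ is the (essentially unique) proper hyperbolic metric space with an action of $\Gamma\times(\mathbb{R}\rtimes\mathbb{Z}/2\mathbb{Z})$ such that $\Gamma\times\mathbb{Z}/2\mathbb{Z}$ acts isometrically, every orbit map $\Gamma\to\hat\Gamma$ is a quasi-isometry, the $\mathbb{R}$-action $\phi_t$ is free with quasi-isometrically embedded orbits, and the induced map $(\tau^+,\tau^-):\hat\Gamma/\mathbb{R}\to\partial_\infty\Gamma^{(2)}$ (endpoints of orbits) is a homeomorphism. A representation $\rho:\Gamma\to G$ is $(P^+,P^-)$-Anosov if there are continuous $\rho$-equivariant maps $\xi^\pm:\partial_\infty\Gamma\to\mathcal{F}^\pm$ such that (1) $(\xi^+(t^+),\xi^-(t^-))$ is transverse for all $(t^+,t^-)\in\partial_\infty\Gamma^{(2)}$; (2) for one (hence any) continuous equivariant family of norms $\|\cdot\|_{\hat m}$, $\hat m\in\hat\Gamma$, on $T_{\xi^+(\tau^+(\hat m))}\mathcal{F}^+$ (resp.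 $T_{\xi^-(\tau^-(\hat m))}\mathcal{F}^-$) there are $A,a>0$ with $\|e\|_{\phi_{-t}(\hat m)}\le Ae^{-at}\|e\|_{\hat m}$ (resp. $\|e\|_{\phi_t(\hat m)}\le Ae^{-at}\|e\|_{\hat m}$) for all $t\ge0$, $\hat m$, $e$. Domain of discontinuity. $\mathcal{X}=G/H$ with $H$ a parabolic or a symmetric subgroup of $G$. $\Omega_\rho\subset\mathcal{X}$ is a domain of discontinuity for $\rho$: an open $\rho(\Gamma)$-invariant subset such that for every compact $K\subset\Omega_\rho$ the set $\{\gamma\in\Gamma:\rho(\gamma)K\cap K\ne\emptyset\}$ is finite. When the functor is considered, $\Omega_\rho$ is a complex curve with $\rho(\Gamma)$ acting by biholomorphisms, or is empty. $\mathrm{Hom}(G,G)$ is the set of group homomorphisms $G\to G$. Identity morphisms are $\mathrm{id}_G$. The group $F^{ab}_\rho$. On $\rho(\Gamma)$ put $g\sim g'$ iff $g$ and $g'$ induce the same map of $\Omega_\rho$, and let $\overline{\rho(\Gamma)}=\rho(\Gamma)/\sim$. For $g\in\rho(\Gamma)$, $\mathcal{E}^g_\rho=g^*T^{1,0}\Omega_\rho$ is the pullback of the $(1,0)$-part of the complexified tangent bundle; $\mathcal{E}_\rho^g=\mathcal{E}_\rho^h$ as generators iff $g\sim h$. $F^{ab}_\rho$ is the free abelian group on $\{\mathcal{E}^g_\rho\}_{[g]\in\overline{\rho(\Gamma)}}$, with (formal) tensor product as group law, identity the trivial line bundle $\mathcal{O}$, and inverses given by duals $(\mathcal{E}^g_\rho)^*$.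 Conventions for the empty domain: if $\Omega_\rho=\emptyset$, then $\rho(\Gamma)$ is taken to act trivially on $\emptyset$ and $F^{ab}_\rho$ is the trivial group; if $\Omega_\rho$ or $\Omega_{\rho'}$ is empty, $\mathcal{F}(\phi)$ is the trivial homomorphism.
   Formalization: Functoriality is claimed only when the chosen domains are all nonempty or all empty; for mixed choices, with the trivial-map convention, composing trivial homomorphisms ρ→ρ'→ρ through an empty domain breaks F(ψφ)=F(ψ)F(φ). *)

(* Defs.v *)
From HB Require Import structures.
From mathcomp Require Import all_boot all_order all_algebra.
From mathcomp Require Import all_classical all_reals all_analysis.
From mathcomp Require Import complex.
From mathcomp.multinomials Require Import freeg.

Set Implicit Arguments.
Unset Strict Implicit.
Unset Printing Implicit Defensive.

Import Order.TTheory GRing.Theory Num.Theory.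
Import numFieldNormedType.Exports.

Local Open Scope classical_set_scope.
Local Open Scope ring_scope.

(** * Categories and functors *)

(* The morphisms from [x] to [y] are the elements of the set [cat_hom x y] inside
   an ambient type [cat_arr x y]; identities and composition live on the ambient
   types, so that closure of [cat_hom] is part of being a category. *)
Record category_data := CategoryData {
  cat_ob : Type;
  cat_arr : cat_ob -> cat_ob -> Type;
  cat_hom : forall x y, set (cat_arr x y);
  cat_id : forall x, cat_arr x x;
  cat_comp : forall x y z, cat_arr y z -> cat_arr x y -> cat_arr x z }.

Arguments cat_hom : clear implicits.
Arguments cat_id : clear implicits.
Arguments cat_comp {c x y z}.

Record is_category (C : category_data) : Prop := IsCategory {
  hom_cat_id : forall x, cat_hom C x x (cat_id C x);
  hom_cat_comp : forall x y z (g : cat_arr y z) (f : cat_arr x y),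
    cat_hom C y z g -> cat_hom C x y f -> cat_hom C x z (cat_comp g f);
  cat_compA : forall x y z t (h : cat_arr z t) (g : cat_arr y z) (f : cat_arr x y),
    cat_hom C z t h -> cat_hom C y z g -> cat_hom C x y f ->
    cat_comp h (cat_comp g f) = cat_comp (cat_comp h g) f;
  cat_idl : forall x y (f : cat_arr x y), cat_hom C x y f -> cat_comp (cat_id C y) f = f;
  cat_idr : forall x y (f : cat_arr x y), cat_hom C x y f -> cat_comp f (cat_id C x) = f }.

Record is_functor (C D : category_data) (F0 : cat_ob C -> cat_ob D)
    (F1 : forall x y, cat_arr x y -> cat_arr (F0 x) (F0 y)) : Prop := IsFunctor {
  functor_hom : forall x y (f : cat_arr x y),
    cat_hom C x y f -> cat_hom D (F0 x) (F0 y) (F1 x y f);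
  functor_id : forall x, F1 x x (cat_id C x) = cat_id D (F0 x);
  functor_comp : forall x y z (g : cat_arr y z) (f : cat_arr x y),
    cat_hom C y z g -> cat_hom C x y f ->
    F1 x z (cat_comp g f) = cat_comp (F1 y z g) (F1 x y f) }.

Definition Ab : category_data := {|
  cat_ob := zmodType;
  cat_arr A B := A -> B;
  cat_hom A B := [set f : A -> B | {morph f : x y / x + y}];
  cat_id A := idfun;
  cat_comp A B C g f := g \o f |}.

Lemma Ab_is_category : is_category Ab.
Proof.
split=> //= A B C g f g_add f_add x y /=.
by rewrite f_add g_add.
Qed.

(** * Smooth maps and Lie groups *)

Section Smooth.
Context {R : realType} {V W : normedModType R}.

Fixpoint class_C (k : nat) (U : set V) (f : V -> W) : Prop :=
  (forall x, U x -> {for x, continuous f}) /\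
  match k with
  | 0 => True
  | k'.+1 => forall v, (forall x, U x -> derivable f x v) /\
                       class_C k' U (fun x => 'D_v f x)
  end.

Definition smooth_on (U : set V) (f : V -> W) : Prop :=
  open U /\ forall k, class_C k U f.

End Smooth.

(* [cmap] and [cinv] are only meaningful on [cdom] and its image. *)
Record chart (T V : topologicalType) := Chart {
  cdom : set T;
  cmap : T -> V;
  cinv : V -> T;
  cdom_open : open cdom;
  cimage_open : open (cmap @` cdom);
  cmapK : forall x, cdom x -> cinv (cmap x) = x;
  cmap_continuous : forall x, cdom x -> {for x, continuous cmap};
  cinv_continuous : forall x, cdom x -> {for cmap x, continuous cinv} }.

HB.mixin Record isLieGroup (R : realType) G of Group G & Topological G := {
  lie_dim : nat;
  lie_atlas : set (chart G 'rV[R]_lie_dim);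
  lie_hausdorff : hausdorff_space G;
  lie_second_countable : @second_countable G;
  lie_mul_continuous : continuous (fun p : G * G => (p.1 * p.2)%g);
  lie_inv_continuous : continuous (fun x : G => (x^-1)%g);
  lie_atlas_cover : forall x : G, exists2 c, lie_atlas c & cdom c x;
  lie_atlas_smooth : forall a b, lie_atlas a -> lie_atlas b ->
    smooth_on (cmap a @` (cdom a `&` cdom b)) (cmap b \o cinv a);
  lie_mul_smooth : forall a b c, lie_atlas a -> lie_atlas b -> lie_atlas c ->
    smooth_on
      [set p | [/\ (cmap a @` cdom a) p.1, (cmap b @` cdom b) p.2
                 & cdom c (cinv a p.1 * cinv b p.2)%g]]
      (fun p : 'rV[R]_lie_dim * 'rV[R]_lie_dim =>
         cmap c (cinv a p.1 * cinv b p.2)%g);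
  lie_inv_smooth : forall a b, lie_atlas a -> lie_atlas b ->
    smooth_on (cmap a @` (cdom a `&` [set x | cdom b (x^-1)%g]))
      (fun x => cmap b ((cinv a x)^-1)%g) }.

#[short(type="lieGroupType")]
HB.structure Definition LieGroup (R : realType) :=
  {G of isLieGroup R G & Group G & Topological G}.

(** * Lie algebras *)

Section LieAlgebra.
Context {K : fieldType} {V : vectType K} (br : V -> V -> V).
Implicit Types U W I : {vspace V}.

(* For bilinear [br], the span of all [br x y] with [x] in [U], [y] in [W]. *)
Definition brv U W : {vspace V} :=
  <<[seq br x y | x <- vbasis U, y <- vbasis W]>>%VS.

Definition lie_subalgebra U : Prop := (brv U U <= U)%VS.

Definition lie_ideal U I : Prop := (I <= U)%VS /\ (brv U I <= I)%VS.

Definition lie_solvable U : Prop :=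
  exists k, iter k (fun W => brv W W) U = 0%VS.

Definition lie_nilpotent U : Prop := exists k, iter k (brv U) U = 0%VS.

Definition lie_semisimple : Prop :=
  forall I, lie_ideal fullv I -> lie_solvable I -> I = 0%VS.

Definition lie_nilradical U N : Prop :=
  [/\ lie_ideal U N, lie_nilpotent N
    & forall I, lie_ideal U I -> lie_nilpotent I -> (I <= N)%VS].

Definition borel_subalgebra U : Prop :=
  [/\ lie_subalgebra U, lie_solvable U
    & forall W, lie_subalgebra W -> lie_solvable W -> (U <= W)%VS -> W = U].

End LieAlgebra.

Section Complexification.
Context {R : realType} {n : nat}.

Definition reV (z : 'rV[R[i]]_n) : 'rV[R]_n := map_mx (@complex.Re R) z.
Definition imV (z : 'rV[R[i]]_n) : 'rV[R]_n := map_mx (@complex.Im R) z.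
Definition complexV (x y : 'rV[R]_n) : 'rV[R[i]]_n :=
  \row_j Complex (x ord0 j) (y ord0 j).

Definition complex_bracket (br : 'rV[R]_n -> 'rV[R]_n -> 'rV[R]_n)
    (z w : 'rV[R[i]]_n) : 'rV[R[i]]_n :=
  complexV (br (reV z) (reV w) - br (imV z) (imV w))
           (br (reV z) (imV w) + br (imV z) (reV w)).

(* A subalgebra whose complexification contains a Borel subalgebra. *)
Definition parabolic_subalgebra (br : 'rV[R]_n -> 'rV[R]_n -> 'rV[R]_n)
    (p : {vspace 'rV[R]_n}) : Prop :=
  lie_subalgebra br p /\
  exists2 b : {vspace 'rV[R[i]]_n}, borel_subalgebra (complex_bracket br) b &
    forall z, z \in b -> reV z \in p /\ imV z \in p.

End Complexification.

Section LieGroups.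
Context {R : realType} {G : lieGroupType R}.

Local Notation Lie := 'rV[R]_(@lie_dim R G).

(* The Lie algebra of [G] is the tangent space at [1], read in the following
   chart. *)
Definition id_chart : chart G Lie := s2val (cid2 (lie_atlas_cover (1%g : G))).

Definition Ad (g : G) (X : Lie) : Lie :=
  'D_X (fun x => cmap id_chart (g * cinv id_chart x * g^-1)%g)
       (cmap id_chart 1%g).

(* The Lie bracket: [ad] is the derivative of [Ad] at [1]. *)
Definition ad (X Y : Lie) : Lie :=
  'D_X (fun x => Ad (cinv id_chart x) Y) (cmap id_chart 1%g).

Definition is_subgroup (H : set G) : Prop :=
  [/\ H 1%g, forall x y, H x -> H y -> H (x * y)%g & forall x, H x -> H (x^-1)%g].

(* The Lie algebra of a closed subgroup: velocities at [1] of curves in [H]. *)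
Definition lie_of_subgroup (H : set G) : set Lie :=
  [set X | exists c : R -> G,
     [/\ forall t, H (c t), c 0 = 1%g, {for 0, continuous c}
       & is_derive (0 : R) (1 : R) (cmap id_chart \o c) X]].

Definition normalizer_of (p : {vspace Lie}) : set G :=
  [set g | Ad g @` [set X | X \in p] = [set X | X \in p]].

Definition parabolic_subgroup (P : set G) : Prop :=
  exists2 p : {vspace Lie}, parabolic_subalgebra ad p & P = normalizer_of p.

(* Two parabolic subgroups are opposite when their intersection is a Levi
   subgroup of both, i.e. when the intersection of their Lie algebras is a
   complement of the nilradical of each of them. *)
Definition opposite_parabolics (Pp Pm : set G) : Prop :=
  exists pp pm np nm : {vspace Lie},
  [/\ parabolic_subalgebra ad pp /\ parabolic_subalgebra ad pm,
      Pp = normalizer_of pp /\ Pm = normalizer_of pm,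
      lie_nilradical ad pp np /\ lie_nilradical ad pm nm,
      (pp :&: pm + np = pp)%VS /\ (pp :&: pm :&: np = 0)%VS
    & (pp :&: pm + nm = pm)%VS /\ (pp :&: pm :&: nm = 0)%VS].

Definition smooth_endomap (s : G -> G) : Prop :=
  continuous s /\
  forall a b : chart G Lie, lie_atlas a -> lie_atlas b ->
    smooth_on (cmap a @` (cdom a `&` s @^-1` cdom b)) (cmap b \o s \o cinv a).

(* [H] is a union of components of the fixed group of an involution. *)
Definition symmetric_subgroup (H : set G) : Prop :=
  is_subgroup H /\
  exists s : G -> G,
  [/\ {morph s : x y / (x * y)%g}, smooth_endomap s, involutive s
    & connected_component [set x | s x = x] 1%g `<=` H
      /\ H `<=` [set x | s x = x]].

End LieGroups.

Definition semisimple_lie_group (R : realType) (G : lieGroupType R) : Prop :=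
  lie_semisimple (@ad R G).

(** * Homogeneous spaces *)

Section Cosets.
Context {G : groupType}.

Definition lcos (H : set G) (a : G) : set G := [set (a * h)%g | h in H].

Record coset (H : set G) := Coset {
  cset : set G;
  csetP : exists a, cset = lcos H a }.

Definition to_coset (H : set G) (a : G) : coset H :=
  @Coset H (lcos H a) (ex_intro _ a erefl).

Lemma act_subproof (H : set G) (g : G) (x : coset H) :
  exists a, [set (g * y)%g | y in cset x] = lcos H a.
Proof.
case: x => A [a /= ->]; exists (g * a)%g; apply/seteqP; split=> y /=.
  by move=> [_ [h Hh <-] <-]; exists h => //; rewrite mulgA.
by move=> [h Hh <-]; exists (a * h)%g; [exists h|rewrite mulgA].
Qed.

Definition act (H : set G) (g : G) (x : coset H) : coset H :=
  Coset (act_subproof g x).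

HB.instance Definition _ (H : set G) := gen_eqMixin (coset H).
HB.instance Definition _ (H : set G) := gen_choiceMixin (coset H).

End Cosets.

Section CosetTopology.
Context {R : realType} {G : lieGroupType R} (H : set G).

Definition coset_open (U : set (coset H)) : Prop :=
  open (to_coset H @^-1` U).

Let coset_openT : coset_open setT.
Proof. by rewrite /coset_open preimage_setT; exact: openT. Qed.

Let coset_openI (A B : set (coset H)) :
  coset_open A -> coset_open B -> coset_open (A `&` B).
Proof. by move=> oA oB; exact: openI. Qed.

Let coset_open_bigcup (I : Type) (f : I -> set (coset H)) :
  (forall i, coset_open (f i)) -> coset_open (\bigcup_i f i).
Proof. by move=> of_; apply: bigcup_open => i _; exact: of_. Qed.

HB.instance Definition _ := isOpenTopological.Build (coset H)
  coset_openT coset_openI coset_open_bigcup.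

(* The Lie algebra of the stabilizer of [x]; the infinitesimal action
   identifies the tangent space of [G/H] at [x] with the quotient of the Lie
   algebra of [G] by [isotropy x]. *)
Definition isotropy (x : coset H) : set 'rV[R]_(@lie_dim R G) :=
  lie_of_subgroup [set g | act g x = x].

End CosetTopology.

(** * Hyperbolic groups *)

Definition gromov_product (R : realType) (T : Type) (d : T -> T -> R)
    (o x y : T) : R := (d x o + d y o - d x y) / 2.

Definition gromov_hyperbolic (R : realType) (T : Type) (d : T -> T -> R) :
    Prop :=
  exists delta : R, forall o x y z,
    Num.min (gromov_product d o x y) (gromov_product d o y z) - delta
      <= gromov_product d o x z.

Section WordMetric.
Context (R : realType) {Gam : groupType} (S : seq Gam).

Definition is_word (s : seq Gam) : Prop :=
  {subset s <= S ++ [seq (x^-1)%g | x <- S]}.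

Definition word_val (s : seq Gam) : Gam :=
  foldr (fun x y => (x * y)%g) 1%g s.

Definition generates : Prop :=
  forall g, exists2 s, is_word s & word_val s = g.

Definition word_dist (x y : Gam) : R :=
  inf [set (size s)%:R | s in
        [set s | is_word s /\ word_val s = (x^-1 * y)%g]].

Definition hyperbolic_generators : Prop :=
  generates /\ gromov_hyperbolic word_dist.

Local Notation "<< x | y >>" := (gromov_product word_dist 1%g x y).

Definition asymptotic (u v : nat -> Gam) : Prop :=
  forall M : R, exists N : nat,
    forall i j, (N <= i)%N -> (N <= j)%N -> M <= <<u i | v j>>.

Definition to_infinity (u : nat -> Gam) : Prop := asymptotic u u.

Record boundary := Boundary {
  bclass : set (nat -> Gam);
  bclassP : exists2 u, to_infinity u &
    bclass = [set v | to_infinity v /\ asymptotic u v] }.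

HB.instance Definition _ := gen_eqMixin boundary.
HB.instance Definition _ := gen_choiceMixin boundary.

Definition bnear (M : R) (x y : boundary) : Prop :=
  exists u v, [/\ bclass x u, bclass y v &
    exists N : nat, forall i j, (N <= i)%N -> (N <= j)%N -> M <= <<u i | v j>>].

Definition boundary_open (U : set boundary) : Prop :=
  forall x, U x -> exists M, forall y, bnear M x y -> U y.

Let boundary_openT : boundary_open setT.
Proof. by move=> x _; exists 0. Qed.

Let boundary_openI (A B : set boundary) :
  boundary_open A -> boundary_open B -> boundary_open (A `&` B).
Proof.
move=> oA oB x [/oA[M AM] /oB[M' BM']]; exists (Num.max M M').
move=> y [u [v [xu yv [N uvN]]]]; split.
  by apply: AM; exists u, v; split=> //; exists N => i j Ni Nj;
     apply: le_trans (uvN i j Ni Nj); rewrite le_max lexx.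
by apply: BM'; exists u, v; split=> //; exists N => i j Ni Nj;
   apply: le_trans (uvN i j Ni Nj); rewrite le_max lexx orbT.
Qed.

Let boundary_open_bigcup (I : Type) (f : I -> set boundary) :
  (forall i, boundary_open (f i)) -> boundary_open (\bigcup_i f i).
Proof.
by move=> of_ x [i _ /of_[M fM]]; exists M => y /fM fy; exists i.
Qed.

HB.instance Definition _ := isOpenTopological.Build boundary
  boundary_openT boundary_openI boundary_open_bigcup.

(* [y] is the image of [x] under [g]. *)
Definition boundary_act (g : Gam) (x y : boundary) : Prop :=
  exists2 u, bclass x u & bclass y (fun n => g * u n)%g.

Definition off_diagonal : set (boundary * boundary) :=
  [set p | p.1 <> p.2].

End WordMetric.

(** * The flow space *)

Section FlowSpace.
Context (R : realType) {Gam : groupType} (S : seq Gam).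

Definition quasi_isometric_embedding (T U : Type) (d : T -> T -> R)
    (d' : U -> U -> R) (f : T -> U) : Prop :=
  exists L C : R, [/\ 1 <= L, 0 <= C &
    forall x y, d x y / L - C <= d' (f x) (f y) <= L * d x y + C].

Definition quasi_isometry (T U : Type) (d : T -> T -> R)
    (d' : U -> U -> R) (f : T -> U) : Prop :=
  quasi_isometric_embedding d d' f /\
  exists C : R, forall y, exists x, d' (f x) y <= C.

Record flow_space := FlowSpace {
  fs_space :> metricType R;
  fs_act : Gam -> fs_space -> fs_space;
  fs_flow : R -> fs_space -> fs_space;
  fs_flip : fs_space -> fs_space;
  fs_plus : fs_space -> boundary R S;
  fs_minus : fs_space -> boundary R S;
  fs_proper : forall x r, compact [set y : fs_space | mdist x y <= r];
  fs_hyperbolic : gromov_hyperbolic (@mdist R fs_space);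
  fs_act1 : forall x, fs_act 1%g x = x;
  fs_actM : forall g h x, fs_act (g * h)%g x = fs_act g (fs_act h x);
  fs_flow0 : forall x, fs_flow 0 x = x;
  fs_flowD : forall s t x, fs_flow (s + t) x = fs_flow s (fs_flow t x);
  fs_flow_continuous :
    continuous (fun p : R * fs_space => fs_flow p.1 p.2);
  fs_flipK : involutive fs_flip;
  fs_flip_flow : forall t x, fs_flip (fs_flow t x) = fs_flow (- t) (fs_flip x);
  fs_act_flow : forall g t x, fs_act g (fs_flow t x) = fs_flow t (fs_act g x);
  fs_act_flip : forall g x, fs_act g (fs_flip x) = fs_flip (fs_act g x);
  fs_act_isometric : forall g x y, mdist (fs_act g x) (fs_act g y) = mdist x y;
  fs_flip_isometric : forall x y, mdist (fs_flip x) (fs_flip y) = mdist x y;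
  fs_orbit_qi : forall x,
    quasi_isometry (word_dist R S) (@mdist R fs_space) (fun g => fs_act g x);
  fs_flow_free : forall t x, fs_flow t x = x -> t = 0;
  fs_flow_qi : forall x, quasi_isometric_embedding
    (fun s t : R => `|s - t|) (@mdist R fs_space) (fun t => fs_flow t x);
  (* [fs_plus x] and [fs_minus x] are the endpoints of the flow line of [x],
     seen in the boundary of the group through the orbit map of [x]. *)
  fs_plusP : forall x, exists2 u, bclass (fs_plus x) u & exists C : R,
    forall n : nat, mdist (fs_act (u n) x) (fs_flow n%:R x) <= C;
  fs_minusP : forall x, exists2 u, bclass (fs_minus x) u & exists C : R,
    forall n : nat, mdist (fs_act (u n) x) (fs_flow (- n%:R) x) <= C;
  (* The map induced by [(fs_plus, fs_minus)] from the space of flow lines to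
     the pairs of distinct boundary points is a homeomorphism. *)
  fs_ends_off_diagonal : forall x, off_diagonal (fs_plus x, fs_minus x);
  fs_ends_inj : forall x y,
    fs_plus x = fs_plus y /\ fs_minus x = fs_minus y <->
    exists t, y = fs_flow t x;
  fs_ends_surj : forall a b : boundary R S, off_diagonal (a, b) ->
    exists x, fs_plus x = a /\ fs_minus x = b;
  fs_ends_continuous : continuous (fun x => (fs_plus x, fs_minus x));
  fs_ends_quotient : forall W : set (boundary R S * boundary R S),
    W `<=` @off_diagonal R Gam S ->
    open [set x | W (fs_plus x, fs_minus x)] ->
    exists2 O : set (boundary R S * boundary R S),
      open O & W = O `&` @off_diagonal R Gam S }.

End FlowSpace.

(** * Anosov representations *)

Section Anosov.
Context {R : realType} {Gam : groupType} {S : seq Gam} (M : flow_space R S).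
Context {G : lieGroupType R} (Pp Pm : set G).

Local Notation Lie := 'rV[R]_(@lie_dim R G).

(* In the unique open orbit of the diagonal action. *)
Definition transverse (x : coset Pp) (y : coset Pm) : Prop :=
  open [set q : coset Pp * coset Pm | exists g, q = (act g x, act g y)].

Definition equivariant_map (P : set G) (rho : Gam -> G)
    (xi : boundary R S -> coset P) : Prop :=
  forall g x y, boundary_act g x y -> xi y = act (rho g) (xi x).

(* A continuous [rho]-equivariant family of norms on the tangent spaces of
   [G/P] at the points [xi (tau m)].  A norm on the quotient of the Lie algebra
   by [isotropy (xi (tau m))] is a seminorm on the Lie algebra with kernel
   [isotropy (xi (tau m))], and [G] acts on tangent vectors through [Ad]. *)
Definition norm_family (P : set G) (rho : Gam -> G)
    (xi : boundary R S -> coset P) (tau : M -> boundary R S)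
    (N : M -> Lie -> R) : Prop :=
  [/\ forall m X Y, N m (X + Y) <= N m X + N m Y,
      forall m (a : R) X, N m (a *: X) = `|a| * N m X,
      forall m X, N m X = 0 <-> isotropy (xi (tau m)) X,
      continuous (fun p : M * Lie => N p.1 p.2)
    & forall g m X, N (fs_act g m) (Ad (rho g) X) = N m X].

Definition contracting (N : M -> Lie -> R) (sgn : R) : Prop :=
  exists A a : R, [/\ 0 < A, 0 < a & forall t m X, 0 <= t ->
    N (fs_flow (sgn * t) m) X <= A * expR (- a * t) * N m X].

Definition anosov (rho : Gam -> G) : Prop :=
  exists (xip : boundary R S -> coset Pp) (xim : boundary R S -> coset Pm),
  [/\ continuous xip /\ continuous xim,
      equivariant_map rho xip /\ equivariant_map rho xim,
      forall a b, off_diagonal (a, b) -> transverse (xip a) (xim b),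
      exists2 N, norm_family rho xip (@fs_plus R Gam S M) N
               & contracting N (-1)
    & exists2 N, norm_family rho xim (@fs_minus R Gam S M) N
               & contracting N 1].

Record anosov_rep := AnosovRep {
  rep :> Gam -> G;
  rep_morph : {morph rep : x y / (x * y)%g};
  rep_anosov : anosov rep }.

Definition domain_of_discontinuity (H : set G) (rho : Gam -> G)
    (Om : set (coset H)) : Prop :=
  [/\ open Om,
      forall g x, Om x -> Om (act (rho g) x)
    & forall K, compact K -> K `<=` Om ->
        finite_set [set g | (act (rho g) @` K) `&` K !=set0]].

(** * The category of Anosov representations *)

Definition An_hom (H : set G) (Om : anosov_rep -> set (coset H))
    (rho rho' : anosov_rep) : set (G -> G) :=
  [set phi : G -> G | [/\ {morph phi : x y / (x * y)%g},
     forall g, range rho g -> range rho' (phi g)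
   & forall g h, range rho g -> range rho h ->
       (forall x, Om rho x -> act g x = act h x) ->
       forall x, Om rho' x -> act (phi g) x = act (phi h) x]].

Definition An (H : set G) (Om : anosov_rep -> set (coset H)) :
    category_data := {|
  cat_ob := anosov_rep;
  cat_arr _ _ := G -> G;
  cat_hom := An_hom Om;
  cat_id _ := idfun;
  cat_comp _ _ _ psi phi := psi \o phi |}.

End Anosov.

(** * Complex curves *)

(* [R[i]] as a numFieldType, so that it receives its topology. *)
Definition Cx (R : realType) : numFieldType := R[i].

Section ComplexCurve.
Context {R : realType} {G : lieGroupType R} {H : set G}.

Local Notation Lie := 'rV[R]_(@lie_dim R G).
Local Notation C := (Cx R).
Local Notation cchart := (chart (coset H) C).

(* [f] is smooth on the open subset [U] of [G/H]. *)
Definition smooth_on_coset (U : set (coset H)) (f : coset H -> R) : Prop :=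
  forall a : chart G Lie, lie_atlas a ->
    smooth_on (cmap a @` (cdom a `&` to_coset H @^-1` U))
      (fun x => f (to_coset H (cinv a x)) : R^o).

(* The structure of a one-dimensional complex manifold on the open subset [Om]
   of [G/H], inducing its topology and its smooth structure. *)
Record complex_curve (Om : set (coset H)) := ComplexCurve {
  cc_atlas : set cchart;
  cc_dom : forall c, cc_atlas c -> cdom c `<=` Om;
  cc_cover : forall x, Om x -> exists2 c, cc_atlas c & cdom c x;
  cc_holomorphic : forall c c' x, cc_atlas c -> cc_atlas c' ->
    cdom c x -> cdom c' x ->
    derivable (cmap c' \o cinv c : C -> C) (cmap c x) 1;
  cc_smooth : forall c, cc_atlas c -> forall U, open U -> U `<=` cdom c ->
    forall f : C -> R,
      smooth_on [set p : R^o * R^o | (cmap c @` U) (Complex p.1 p.2)]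
        (fun p : R^o * R^o => f (Complex p.1 p.2) : R^o) <->
      smooth_on_coset U (f \o cmap c) }.

Variables (Om : set (coset H)) (Z : complex_curve Om).

Definition acts_biholomorphically (Gam : groupType) (rho : Gam -> G) : Prop :=
  forall g c c' x, cc_atlas Z c -> cc_atlas Z c' ->
    cdom c x -> cdom c' (act (rho g) x) ->
    derivable (cmap c' \o act (rho g) \o cinv c : C -> C) (cmap c x) 1.

(* A complexified tangent vector at [y] is given in each chart around [y] by a
   pair [(u, w)] standing for [u (x) 1 + w (x) i] in the tensor product over R
   of the real tangent space, which the chart identifies with [C], and [C].
   Coordinates change through the derivative of the transition map. *)
Definition ctangent (y : coset H) : set (cchart -> C * C) :=
  [set v | (forall c c', cc_atlas Z c -> cc_atlas Z c' ->
              cdom c y -> cdom c' y ->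
              let d := derive1 (cmap c' \o cinv c : C -> C) (cmap c y) in
              v c' = (d * (v c).1, d * (v c).2)) /\
           (forall c, ~ (cc_atlas Z c /\ cdom c y) -> v c = (0, 0))].

(* The complex structure of the real tangent space, and the scalar
   multiplication by [i] of the complexification. *)
Definition tangent_J (v : cchart -> C * C) : cchart -> C * C :=
  fun c => ('i%C * (v c).1, 'i%C * (v c).2).
Definition tangent_i (v : cchart -> C * C) : cchart -> C * C :=
  fun c => (- (v c).2, (v c).1).

Definition T10 (y : coset H) : set (cchart -> C * C) :=
  [set v | ctangent y v /\ tangent_J v = tangent_i v].

(* The total space of the pullback by [g] of the bundle [T10], as a subset of
   the product of [Om] and the total space of [T10]. *)
Definition pullback_T10 (g : G) : set (coset H * (coset H * (cchart -> C * C))) :=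
  [set p | [/\ Om p.1, p.2.1 = act g p.1 & T10 p.2.1 p.2.2]].

(* The generators of the free abelian group of [rho]; there are none when [Om]
   is empty. *)
Record generator (Gam : groupType) (rho : Gam -> G) := Generator {
  bundle : set (coset H * (coset H * (cchart -> C * C)));
  bundleP : exists g, [/\ range rho g, Om !=set0 & bundle = pullback_T10 g] }.

HB.instance Definition _ (Gam : groupType) (rho : Gam -> G) :=
  gen_eqMixin (generator rho).
HB.instance Definition _ (Gam : groupType) (rho : Gam -> G) :=
  gen_choiceMixin (generator rho).

Definition Fab (Gam : groupType) (rho : Gam -> G) : zmodType :=
  {freeg (generator rho)}.

(* The class of the pullback bundle by [g] in the free abelian group. *)
Definition gen (Gam : groupType) (rho : Gam -> G) (g : G)
    (rho_g : range rho g) (Om_ne : Om !=set0) : Fab rho :=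
  << @Generator Gam rho (pullback_T10 g) (ex_intro _ g (And3 rho_g Om_ne erefl)) >>.

End ComplexCurve.

(* [f] is the homomorphism induced by [phi]. *)
Definition induced_hom (R : realType) (G : lieGroupType R) (H : set G)
    (Gam : groupType) (rho rho' : Gam -> G) (Om Om' : set (coset H))
    (Z : complex_curve Om) (Z' : complex_curve Om') (phi : G -> G)
    (f : Fab Z rho -> Fab Z' rho') : Prop :=
  [/\ {morph f : x y / x + y},
      forall h (rho_h : range rho h) (rho'_phih : range rho' (phi h))
             (Om_ne : Om !=set0) (Om'_ne : Om' !=set0),
        f (gen Z rho_h Om_ne) = gen Z' rho'_phih Om'_ne
    & Om = set0 \/ Om' = set0 -> forall x, f x = 0].

(* Main.v *)
Require Import Defs.
From HB Require Import structures.
From mathcomp Require Import all_boot all_order all_algebra.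
From mathcomp Require Import all_classical all_reals all_analysis.
From mathcomp.multinomials Require Import freeg.

Set Implicit Arguments.
Unset Strict Implicit.
Unset Printing Implicit Defensive.

Import Order.TTheory GRing.Theory Num.Theory.
Local Open Scope classical_set_scope.
Local Open Scope ring_scope.

(* The bundle pulled back along [g] determines the action of [g] on the domain:
   its zero section over [x] sits at [act g x].  Hence two generators coincide
   exactly when their indices act equally on the domain, which is the relation
   that morphisms respect, so [phi] acts on generators and the universal property
   of free abelian groups does the rest.  When the source domain is empty there
   are no generators. *)

Section FreeAbelianGroup.
Context {K : choiceType} {V : zmodType}.

(** Every element is a finite sum of integer multiples of generators, and additive maps commute with
    such sums. *)
Lemma freeg_morph_ext (f g : {freeg K} -> V) :
  {morph f : x y / x + y} -> {morph g : x y / x + y} ->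
  (forall k, f << k >> = g << k >>) -> f =1 g.
Proof.
move=> fD gD fg D.
have fB : zmod_morphism f.
  by move=> x y; apply: (@addIr _ (f y)); rewrite -fD !subrK.
have gB : zmod_morphism g.
  by move=> x y; apply: (@addIr _ (g y)); rewrite -gD !subrK.
pose fA : {additive {freeg K} -> V} :=
  HB.pack f (GRing.isZmodMorphism.Build _ _ f fB).
pose gA : {additive {freeg K} -> V} :=
  HB.pack g (GRing.isZmodMorphism.Build _ _ g gB).
rewrite -[LHS]/(fA D) -[RHS]/(gA D) -(freeg_sumE D) !raddf_sum; apply: eq_bigr => k _.
by rewrite -[coeff k D]intz -freegU_mulz !raddfMz /= fg.
Qed.

Lemma freeg_morph_exists (u : K -> V) :
  exists2 f : {freeg K} -> V, {morph f : x y / x + y} & forall k, f << k >> = u k.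
Proof.
(* [fglift] takes values in a module over the coefficient ring, so [V] is viewed as a module over
   the integers through [zmodule]. *)
pose u' : K -> zmodule V := u.
have fB := lift_is_additive u'.
exists (fglift u') => [x y|k]; last by rewrite liftU scale1r.
pose fA : {additive {freeg K} -> zmodule V} :=
  HB.pack (fglift u') (GRing.isZmodMorphism.Build _ _ (fglift u') fB).
exact: (raddfD fA).
Qed.

(** The support of [<< k >>] is the one-element list of [k], which recovers [k]. *)
Lemma freegU_inj : injective (fun k : K => << k >> : {freeg K}).
Proof.
by move=> k l /(congr1 (@dom _ _)); rewrite !domU1 => -[].
Qed.

End FreeAbelianGroup.

Section Generators.
Context {R : realType} {G : lieGroupType R} {H : set G} {Om : set (coset H)}.
Variable Z : complex_curve Om.

(** Ensures that no fibre is empty, so that a pulled-back bundle remembers the map it was pulled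
    back along. *)
Lemma T10_0 (y : coset H) : T10 Z y (fun=> (0, 0)).
Proof.
split; first by split=> // c c' _ _ _ _; rewrite /= !mulr0.
by rewrite /tangent_J /tangent_i /= mulr0 oppr0.
Qed.

Lemma pullback_T10_eq (g h : G) :
  pullback_T10 Z g = pullback_T10 Z h <->
  forall x, Om x -> act g x = act h x.
Proof.
split=> [gh x Omx|gh].
  have : pullback_T10 Z g (x, (act g x, fun=> (0, 0))).
    by split=> //; exact: T10_0.
  by rewrite gh => -[].
by apply/seteqP; split=> -[x [y v]] [/= Omx -> ?]; split; rewrite //= gh.
Qed.

Context {Gam : groupType} {rho : Gam -> G}.

Lemma gen_eq (g h : G) (rho_g : range rho g) (rho_h : range rho h)
    (Om_ne Om_ne' : Om !=set0) :
  gen Z rho_g Om_ne = gen Z rho_h Om_ne' <->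
  forall x, Om x -> act g x = act h x.
Proof.
rewrite -pullback_T10_eq; split=> [/freegU_inj/(congr1 (@bundle _ _ _ _ _ _ _))//|gh].
rewrite /gen; congr (<< _ >>).
(* The types of the two existence proofs mention the bundles, so the proofs are generalized before
   rewriting; proof irrelevance then identifies them. *)
move: (ex_intro _ _ _) (ex_intro _ _ _); rewrite gh => p q.
by congr Generator; exact: Prop_irrelevance.
Qed.

Lemma genP (k : generator Z rho) :
  exists g (rho_g : range rho g) (Om_ne : Om !=set0), << k >> = gen Z rho_g Om_ne.
Proof.
case: k => B [g [rho_g Om_ne eB]]; subst B.
by exists g, rho_g, Om_ne.
Qed.

Lemma Fab_morph_ext (V : zmodType) (e f : Fab Z rho -> V) :
  {morph e : x y / x + y} -> {morph f : x y / x + y} ->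
  (forall g (rho_g : range rho g) (Om_ne : Om !=set0),
    e (gen Z rho_g Om_ne) = f (gen Z rho_g Om_ne)) ->
  e = f.
Proof.
move=> eD fD ef; apply/funext; apply: freeg_morph_ext => // k.
by have [g [rho_g [Om_ne ->]]] := genP k; exact: ef.
Qed.

End Generators.

Section InducedHom.
Context {R : realType} {G : lieGroupType R} {H : set G} {Gam : groupType}.
Context {rho rho' : Gam -> G} {Om Om' : set (coset H)}.
Variables (Z : complex_curve Om) (Z' : complex_curve Om') (phi : G -> G).
Hypothesis phi_range : forall g, range rho g -> range rho' (phi g).

(** Over a nonempty target domain the values on generators are prescribed. Over an empty one that
    clause is vacuous, and the last clause of [induced_hom] forces both maps to be zero. *)
Lemma induced_hom_unique (e f : Fab Z rho -> Fab Z' rho') :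
  induced_hom phi e -> induced_hom phi f -> e = f.
Proof.
move=> [eD eg e0] [fD fg f0].
have [Om'0|/set0P Om'_ne] := eqVneq Om' set0.
  by apply/funext => x; rewrite e0 ?f0 //; right.
apply: Fab_morph_ext => // g rho_g Om_ne.
have rho'_phig := phi_range rho_g.
by rewrite (eg _ _ rho'_phig _ Om'_ne) (fg _ _ rho'_phig _ Om'_ne).
Qed.

Hypothesis phi_compat : forall g h, range rho g -> range rho h ->
  (forall x, Om x -> act g x = act h x) ->
  forall x, Om' x -> act (phi g) x = act (phi h) x.

Lemma induced_hom_exists : exists f : Fab Z rho -> Fab Z' rho', induced_hom phi f.
Proof.
have [Om'0|/set0P Om'_ne] := eqVneq Om' set0.
  exists (fun=> 0); split=> // [x y|]; first by rewrite addr0.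
  by move=> h ? ? ? Om'_ne; have [x] := Om'_ne; rewrite {1}Om'0.
(* A generator may be represented by several [h], and its image must be right for all of them at
   once; [phi_compat] makes this possible. *)
have /choice[u uP] : forall k : generator Z rho, exists y : Fab Z' rho',
    forall h (rho_h : range rho h) (rho'_phih : range rho' (phi h))
           (Om_ne : Om !=set0) (Om'_ne : Om' !=set0),
      << k >> = gen Z rho_h Om_ne -> y = gen Z' rho'_phih Om'_ne.
  move=> k; have [g [rho_g [Om_ne ->]]] := genP k.
  exists (gen Z' (phi_range rho_g) Om'_ne) => h rho_h rho'_phih ? ? /gen_eq gh.
  by apply/gen_eq; exact: phi_compat.
have [f fD fu] := freeg_morph_exists u.
exists f; split=> // [h rho_h rho'_phih Om_ne ?|[Om0|Om'0] x].
- by rewrite /gen fu; exact: uP.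
(* There are no generators over an empty source domain, so all additive maps out of [Fab Z rho]
   agree. *)
- have -> // : f = fun=> 0.
  apply: (@Fab_morph_ext _ _ _ _ Z _ rho) => // [? ?|g rho_g Om_ne].
    by rewrite addr0.
  by have [y] := Om_ne; rewrite {1}Om0.
- by case: Om'_ne => y; rewrite {1}Om'0.
Qed.

End InducedHom.

Theorem theorem1p5 (R : realType)
    (Gam : groupType) (S : seq Gam) (hS : hyperbolic_generators R S)
    (M : flow_space R S)
    (G : lieGroupType R) (hG : semisimple_lie_group G)
    (Pp Pm : set G) (hP : opposite_parabolics Pp Pm)
    (H : set G) (hH : parabolic_subgroup H \/ symmetric_subgroup H)
    (Om : anosov_rep M Pp Pm -> set (coset H))
    (hOm : forall rho : anosov_rep M Pp Pm, domain_of_discontinuity rho (Om rho)) :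
  is_category (An Om) /\
  forall (Z : forall rho : anosov_rep M Pp Pm, complex_curve (Om rho)),
    (forall rho : anosov_rep M Pp Pm, acts_biholomorphically (Z rho) rho) ->
    (forall (rho rho' : cat_ob (An Om)) (phi : G -> G), cat_hom (An Om) rho rho' phi ->
       exists! f : Fab (Z rho) rho -> Fab (Z rho') rho',
         induced_hom phi f) /\
    ((forall rho rho' : anosov_rep M Pp Pm, Om rho !=set0 -> Om rho' !=set0) ->
     forall F : forall rho rho' : cat_ob (An Om),
         (G -> G) -> Fab (Z rho) rho -> Fab (Z rho') rho',
       (forall rho rho' phi, cat_hom (An Om) rho rho' phi ->
          induced_hom phi (F rho rho' phi)) ->
       @is_functor (An Om) Ab (fun rho => Fab (Z rho) rho) F).
Proof.
have An_cat : is_category (An Om).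
  split=> //=.
  move=> rho1 rho2 rho3 psi phi [psiM psi_r psi_c] [phiM phi_r phi_c]; split.
  - by move=> x y /=; rewrite phiM psiM.
  - by move=> g /phi_r/psi_r.
  - by move=> g h rg rh /(phi_c _ _ rg rh)/psi_c; apply; exact: phi_r.
split=> // Z _; split=> [rho rho' phi [_ phi_r phi_c]|Om_ne F F_ind].
  have [f f_ind] := induced_hom_exists (Z rho) (Z rho') phi_r phi_c.
  by exists f; split=> // e; exact: induced_hom_unique.
split=> [rho rho' phi /F_ind[] //|rho|rho1 rho2 rho3 psi phi psi_hom phi_hom].
  have [FD Fg _] := F_ind _ _ _ (hom_cat_id An_cat rho).
  (* An empty domain needs no separate case: there is then no generator to compare. *)
  by apply: Fab_morph_ext => // g rho_g Om_rho; rewrite (Fg _ _ rho_g _ Om_rho).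
have [psiD psig _] := F_ind _ _ _ psi_hom.
have [phiD phig _] := F_ind _ _ _ phi_hom.
have [compD compg _] := F_ind _ _ _ (hom_cat_comp An_cat psi_hom phi_hom).
have [_ psi_r _] := psi_hom; have [_ phi_r _] := phi_hom.
apply: Fab_morph_ext => // [x y|g rho_g ne1]; first by rewrite /= phiD psiD.
(* With [Om rho2] empty and the outer domains nonempty, the composite would be zero while the map
   induced by [psi \o phi] sends generators to generators; [Om_ne] excludes this. *)
have ne2 := Om_ne _ rho2 ne1; have ne3 := Om_ne _ rho3 ne1.
rewrite (compg _ _ (psi_r _ (phi_r _ rho_g)) _ ne3) /=.
by rewrite (phig _ _ (phi_r _ rho_g) _ ne2) (psig _ _ (psi_r _ (phi_r _ rho_g)) _ ne3).
Qed.
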